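(* There exist an absolute constant $C>0$ and a function $f:\mathbb{Z}_{\ge 1}\to\mathbb{R}$ with $f(N)\to 0$ as $N\to\infty$ such that for every integer $N\ge 1$, \[ r_3(N) \ge C\, N\, 2^{-(c+f(N))\,2\sqrt{2\log_2(N)}},\qquad\text{where } c:=\sqrt{\log_2\left(\sqrt{\tfrac{32}{9}}\right)}\approx 0.9567 .\]
   Context: A set $S$ of integers is 3-AP-free if the only solutions to $2y=x+z$ with $x,y,z\in S$ are those with $x=y=z$. For an integer $N\ge1$, $r_3(N)$ denotes the maximum cardinality of a 3-AP-free subset of $\{1,\dots,N\}$. *)

(* Defs.v *)
From mathcomp Require Import all_boot.
From Stdlib Require Import Reals.
Set Implicit Arguments. Unset Strict Implicit. Unset Printing Implicit Defensive.

(* r_3(N): maximum cardinality of a 3-AP-free subset of {1,...,N}.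
   Subsets are represented as subsets of 'I_N.+1 avoiding 0. *)
Definition r3 (N : nat) : nat :=
  \max_(A : {set 'I_N.+1} |
         [forall x in A, 0 < val x] &&
         [forall x in A, forall y in A, forall z in A,
            ((val y).*2 == val x + val z) ==> ((x == y) && (y == z))])
    #|A|.

Definition log2 (x : R) : R := (ln x / ln 2)%R.

Definition c_const : R := sqrt (log2 (sqrt (32 / 9))).

(* Main.v *)
(** A point of a product of tori is kept only if each pair of coordinates [(s, t)], taken
    modulo a large prime [p], lies in a planar region of density about [9/32 > 1/4].  The
    region is the square [0, 1/2)^2 without the triangle [s + 1/4 <= t] (the "core"),
    completed by a "tail" of fibres over [1/2 <= s < 3/4], each of which is invariant under
    [t -> t + 1/2], so that the tail has twice the area of the triangle that was removed.
    The height [L * bowl s + (t or 2t)^2] then satisfies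
    [height x + height z >= 2 * height y] for all [x + z = 2y] in the region, wrap-around
    included, with near equality only if [2 (x - z)] is near [0]: when [s] wraps downwards,
    [y] lies in the tail and [2 y_2] misses the sums of two core fibres; when [s] wraps
    upwards, or [x] and [z] lie in different parts, the bowl term dominates because thin
    strips have been removed between the parts.  Hence the points of the [k]-fold product
    whose total height lies in a short interval form a set of density about
    [(9/32)^k N^(-1/k)] in which the difference [d] of a progression has [4 d] close to [0].
    Its preimage under a random affine map [n -> b + a n] contains few progressions, and
    deleting their first terms gives the bound; [k ~ sqrt (ln N / ln (32/9))] is optimal. *)

From HB Require Import structures.
Require Import Defs.
From Stdlib Require Import Reals Lra.
From mathcomp Require Import all_boot all_algebra.
From mathcomp Require Import zify.
Set Implicit Arguments. Unset Strict Implicit. Unset Printing Implicit Defensive.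
Import GRing.Theory.

(** * Progression-free sets from random affine maps *)

Lemma leq_r3 (N : nat) (A : {set 'I_N.+1}) :
  (forall x, x \in A -> 0 < x) ->
  (forall x y z, x \in A -> y \in A -> z \in A -> y.*2 = x + z -> x = y /\ y = z) ->
  #|A| <= r3 N.
Proof.
move=> A0 Afree.
apply: (@bigmax_sup _ A (fun A : {set 'I_N.+1} => _) _ (fun A : {set 'I_N.+1} => #|A|)) => //.
apply/andP; split; first by apply/forall_inP.
apply/forall_inP => x xA; apply/forall_inP => y yA; apply/forall_inP => z zA.
apply/implyP => /eqP e; have [-> ->] := Afree _ _ _ xA yA zA e.
by rewrite !eqxx.
Qed.

Section Sampling.

Variables (V : finZmodType) (N : nat) (S D : {set V}).
Hypothesis mulrn_inj : forall j, 0 < j -> j <= N -> injective (fun a : V => (a *+ j)%R).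
Hypothesis apD : forall x d : V,
  x \in S -> (x + d)%R \in S -> (x + d *+ 2)%R \in S -> d \in D.

(** [ab.1] is the slope and [ab.2] the offset of the affine map. [aps] records a progression by
    first term and positive difference, so [fst] gives the term to delete. *)
Let hits (ab : V * V) (n : nat) := (ab.2 + ab.1 *+ n)%R \in S.
Let sample ab := [set n : 'I_N.+1 | (0 < n) && hits ab n].
Let aps ab := [set nj : 'I_N.+1 * 'I_N.+1 |
  [&& 0 < nj.1, 0 < nj.2, nj.1 + nj.2.*2 <= N,
      hits ab nj.1, hits ab (nj.1 + nj.2) & hits ab (nj.1 + nj.2.*2)]].

(** Deleting the first term of every progression leaves a 3-AP-free set, and each deleted term is
    charged to a progression. *)
Lemma card_sample_le ab : #|sample ab| <= r3 N + #|aps ab|.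
Proof.
set B := fst @: aps ab.
apply: (@leq_trans (#|sample ab :\: B| + #|aps ab|)).
  rewrite -(cardsID B (sample ab)) addnC leq_add2l.
  exact: leq_trans (subset_leq_card (subsetIr _ _)) (leq_imset_card _ _).
rewrite leq_add2r; apply: leq_r3 => [x|x y z].
  by rewrite !inE => /andP[_ /andP[]].
(* [key] excludes increasing progressions; decreasing ones are read backwards below. *)
have key (a c d : 'I_N.+1) : a \in sample ab :\: B -> c \in sample ab -> d \in sample ab ->
    c.*2 = a + d -> a < c -> False.
  rewrite !inE => /andP[/negP aB /andP[a0 ha]] /andP[c0 hc] /andP[d0 hd] e ac.
  have jN : c - a < N.+1 by have := ltn_ord c; lia.
  apply: aB; apply/imsetP; exists (a, Ordinal jN) => //.
  have e1 : a + (c - a) = c by lia.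
  have e2 : a + (c - a).*2 = d by lia.
  rewrite inE /= e1 e2 a0 ha hc hd !andbT subn_gt0 ac /=.
  by have := ltn_ord d; lia.
move=> xA yA zA e.
have sub w : w \in sample ab :\: B -> w \in sample ab by rewrite inE => /andP[].
case: (ltngtP x y) => xy.
- by case: (key _ _ _ xA (sub _ yA) (sub _ zA) e xy).
- have zy : z < y by lia.
  by case: (key _ _ _ zA (sub _ yA) (sub _ xA) _ zy); lia.
- have zy : y = z :> nat by lia.
  by split; apply: val_inj.
Qed.

Lemma sum_card_sample : \sum_ab #|sample ab| = N * (#|V| * #|S|).
Proof.
have cS n (a : V) : #|[set b : V | (b + a *+ n)%R \in S]| = #|S|.
  rewrite -(card_preimset S (@addIr V (a *+ n)%R)).
  by apply: eq_card => b; rewrite !inE.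
transitivity (\sum_ab \sum_(n < N.+1 | 0 < n) (hits ab n : nat)).
  apply: eq_bigr => ab _; rewrite -sum1_card big_mkcond [RHS]big_mkcond /=.
  by apply: eq_bigr => n _; rewrite inE; case: (0 < n); case: (hits _ _).
rewrite exchange_big /= (eq_bigr (fun => #|V| * #|S|)) => [|n _].
  rewrite sum_nat_const; congr (_ * _).
  have := cardC (pred1 (ord0 : 'I_N.+1)); rewrite card1 card_ord => -[e].
  rewrite -[RHS]e; apply: eq_card => i.
  by rewrite !inE [LHS]lt0n.
rewrite -(pair_bigA _ (fun a b : V => (b + a *+ n)%R \in S : nat)) /=.
rewrite (eq_bigr (fun => #|S|)) => [|a _]; first by rewrite sum_nat_const.
rewrite -(cS n a) -sum1_card [RHS]big_mkcond /=.
by apply: eq_bigr => b _; rewrite inE; case: (_ \in S).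
Qed.

(** A progression [(n, j)] forces [a *+ j] into [D], which leaves at most [#|D|] slopes by
    injectivity; for each slope, [#|S|] offsets put the first term in [S]. *)
Lemma sum_card_aps : \sum_ab #|aps ab| <= N * N * (#|D| * #|S|).
Proof.
pose P (nj : 'I_N.+1 * 'I_N.+1) := (0 < nj.1) && (0 < nj.2).
apply: (@leq_trans (\sum_ab \sum_(nj | P nj)
    ((ab.1 *+ nj.2)%R \in D) * ((ab.2 + ab.1 *+ nj.1)%R \in S))).
  apply: leq_sum => ab _; rewrite -sum1_card big_mkcond [X in _ <= X]big_mkcond /=.
  apply: leq_sum => -[n j] _; rewrite inE /P /=.
  case: ifP => // /and5P[-> -> _ h0 /andP[h1 h2]] /=.
  rewrite (_ : (_ \in S) = true) // muln1.
  rewrite (apD h0) //; first by rewrite -addrA -mulrnDr.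
  by rewrite -mulrnA -addrA -mulrnDr muln2.
rewrite exchange_big /=.
apply: (@leq_trans (\sum_(nj | P nj) #|D| * #|S|)).
  apply: leq_sum => -[n j] /andP[/= n0 j0].
  rewrite -(pair_bigA _ (fun a b : V => ((a *+ j)%R \in D) * ((b + a *+ n)%R \in S))) /=.
  under eq_bigr do rewrite -big_distrr /=.
  rewrite (eq_bigr (fun a : V => ((a *+ j)%R \in D) * #|S|)) => [|a _].
    rewrite -big_distrl /= leq_mul2r; apply/orP; right.
    have jN : j <= N by rewrite -ltnS.
    rewrite -(card_preimset D (mulrn_inj j0 jN)) -sum1_card [X in _ <= X]big_mkcond /=.
    by apply: leq_sum => a _; rewrite inE; case: (_ \in D).
  congr (_ * _); rewrite -(card_preimset S (@addIr V (a *+ n)%R)) -sum1_card [RHS]big_mkcond /=.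
  by apply: eq_bigr => b _; rewrite inE; case: (_ \in S).
rewrite sum_nat_const leq_mul2r; apply/orP; right.
have -> : #|P| = #|setX [set~ (ord0 : 'I_N.+1)] [set~ (ord0 : 'I_N.+1)]|.
  by apply: eq_card => -[n j]; rewrite !inE unfold_in /P /= !lt0n.
by rewrite cardsX cardsC1 card_ord.
Qed.

(** First-moment argument: [card_sample_le] is summed over all [ab], and the hypothesis makes the
    progression count at most half of the total sample size. *)
Lemma r3_ge_sampling : 2 * N * #|D| <= #|V| -> N * #|S| <= 2 * #|V| * r3 N.
Proof.
have arith n v s r d x : 0 < v -> x <= n * n * (d * s) -> n * (v * s) <= v * v * r + x ->
    2 * n * d <= v -> n * s <= 2 * v * r.
  move=> v0 xd h dv; rewrite -(leq_pmul2l v0).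
  have : n * s * (2 * n * d) <= n * s * v by rewrite leq_mul2l dv orbT.
  by lia.
apply: arith sum_card_aps _; first by apply/card_gt0P; exists 0%R.
rewrite -sum_card_sample -card_prod -sum_nat_const -big_split /=.
by apply: leq_sum => ab _; apply: card_sample_le.
Qed.

End Sampling.

(** * The planar region and its height *)

(* [p] is the modulus and [H] is about [p / 4]; [b] is the half-width of the removed strips. *)
Definition core (H b s t : nat) :=
  [&& b <= s, s + b <= 2 * H, t < 2 * H & t < H + s].
Definition tail (p H b s t : nat) :=
  [&& 2 * H + b <= s, s <= 3 * H & 2 * H + 2 * s <= (2 * t) %% p + p].
(* Equal to [((4 s - p)^2 + 7 p^2) / 8] when [s <= p]. *)
Definition bowl (p s : nat) := 2 * (s * s) + p * (p - s).
Definition height (p L s t : nat) :=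
  L * bowl p s + (if 2 * s < p then t * t else (2 * t) %% p * ((2 * t) %% p)).

Lemma eqn_mod_cases p a c : a = c %[mod p] -> a < 2 * p -> c < 2 * p ->
  [\/ a = c, a = c + p | c = a + p].
Proof.
move=> e ha hc; have := divn_eq a p; have := divn_eq c p; rewrite e.
have : a %/ p < 2 by rewrite ltn_divLR; lia.
have : c %/ p < 2 by rewrite ltn_divLR; lia.
case: (c %/ p) (a %/ p) => [|[|//]] [|[|//]] _ _ h1 h2.
- by constructor 1; lia.
- by constructor 2; lia.
- by constructor 3; lia.
- by constructor 1; lia.
Qed.

(** In truncated subtraction [x - z + (z - x)] is |x - z|. The leading coefficient 2 of [bowl] makes
    the convexity defect exactly its square. *)
Lemma bowl_mid p x y z : x <= p -> y <= p -> z <= p -> x + z = 2 * y ->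
  bowl p x + bowl p z = 2 * bowl p y + (x - z + (z - x)) * (x - z + (z - x)).
Proof.
rewrite /bowl => xp yp zp e.
have [xz|zx] := leqP x z.
  have [i ei] : exists i, z = x + 2 * i by exists (y - x); lia.
  have ey : y = x + i by lia.
  have -> : x - z + (z - x) = 2 * i by lia.
  have [j ej] : exists j, p = z + j by exists (p - z); lia.
  have -> : p - x = j + 2 * i by lia.
  have -> : p - y = j + i by lia.
  have -> : p - z = j by lia.
  subst z y p; lia.
have [i ei] : exists i, x = z + 2 * i by exists (y - z); lia.
have ey : y = z + i by lia.
have -> : x - z + (z - x) = 2 * i by lia.
have [j ej] : exists j, p = x + j by exists (p - x); lia.
have -> : p - x = j by lia.
have -> : p - y = j + i by lia.
have -> : p - z = j + 2 * i by lia.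
subst x y p; lia.
Qed.

(** The linear coefficient -p of [bowl] cancels the p^2 created by the wrap-around: the excess is
    exactly 4 p y + (x - z)^2. *)
Lemma bowl_up p b x y z : x <= p -> z <= p -> b <= y -> b <= p -> x + z = 2 * y + p ->
  2 * bowl p y + 4 * (b * b) <= bowl p x + bowl p z.
Proof.
rewrite /bowl => xp zp yb bp e.
have := leq_mul bp yb.
have [j ej] : exists j, x + j = p by exists (p - x); lia.
have [k ek] : exists k, z + k = p by exists (p - z); lia.
have [-> -> ->] : [/\ p - x = j, p - z = k & p - y = y + k + j] by split; lia.
have [-> -> ->] : [/\ p = 2 * y + k + j, x = 2 * y + k & z = 2 * y + j] by split; lia.
have : 2 * (k * j) <= k * k + j * j by rewrite !mulnn; apply: (nat_Cauchy k j).1.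
lia.
Qed.

Lemma close_of_sqr (x y z R : nat) : x + z = 2 * y -> x * x + z * z < 2 * (y * y) + 2 * (R * R) ->
  x < z + 2 * R /\ z < x + 2 * R.
Proof.
move=> e h.
suff : (x - z + (z - x)) < 2 * R by lia.
rewrite ltnNge; apply/negP => lt; have := leq_mul lt lt.
have [xz|zx] := leqP x z.
  have [i ei] : exists i, z = x + 2 * i by exists (y - x); lia.
  have -> : x - z + (z - x) = 2 * i by lia.
  have ey : y = x + i by lia.
  by subst z y; lia.
have [i ei] : exists i, x = z + 2 * i by exists (y - z); lia.
have -> : x - z + (z - x) = 2 * i by lia.
have ey : y = z + i by lia.
by subst x y; lia.
Qed.

(** Scaled by [L], the bowl gain is at least 3 p^2. This pays for twice the second-coordinate term
    of [y], which is at most p^2, and for [r]. *)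
Lemma height_far p b L r x1 x2 y1 y2 z1 z2 :
  0 < p -> y2 < p -> 3 * (p * p) <= L * (4 * (b * b)) -> r <= p * p ->
  2 * bowl p y1 + 4 * (b * b) <= bowl p x1 + bowl p z1 ->
  2 * height p L y1 y2 + r <= height p L x1 x2 + height p L z1 z2.
Proof.
move=> p0 y2p Lb rp h; rewrite /height.
have : (if 2 * y1 < p then y2 * y2 else (2 * y2) %% p * ((2 * y2) %% p)) <= p * p.
  by case: ifP => _; apply: leq_mul; rewrite ltnW // ltn_mod.
set f := (if 2 * y1 < p then _ else _); move=> fy.
set fx := (if 2 * x1 < p then _ else _); set fz := (if 2 * z1 < p then _ else _).
have := leq_mul (leqnn L) h; move: fy Lb rp; rewrite !mulnDr; clear.
by generalize (p * p) (b * b) (bowl p x1) (bowl p y1) (bowl p z1) f fx fz; lia.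
Qed.

(** The defects of the bowl and of the second-coordinate term are both nonnegative, so a bound on
    their sum bounds each. *)
Lemma height_near p L R fx fy fz x y z :
  0 < L -> x < p -> y < p -> z < p -> x + z = 2 * y ->
  2 * fy <= fx + fz ->
  L * bowl p x + fx + (L * bowl p z + fz) < 2 * (L * bowl p y + fy) + 2 * (R * R) ->
  [/\ x < z + 2 * R, z < x + 2 * R & fx + fz < 2 * fy + 2 * (R * R)].
Proof.
move=> L0 xp yp zp e ff.
have := bowl_mid (ltnW xp) (ltnW yp) (ltnW zp) e.
have : (x - z + (z - x) < 2 * R) -> x < z + 2 * R /\ z < x + 2 * R by clear; lia.
set d := x - z + (z - x) => hd bm h.
have {bm}: L * (bowl p x + bowl p z) = L * (2 * bowl p y + d * d) by rewrite bm.
have Ld : d * d <= L * (d * d) by rewrite leq_pmull.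
move=> eL.
have h2 : L * (d * d) + fx + fz < 2 * fy + 2 * (R * R).
  move: h eL; rewrite !mulnDr; clear.
  by generalize (bowl p x) (bowl p y) (bowl p z) (d * d) (R * R); lia.
have [] := hd.
  rewrite ltnNge; apply/negP => lt; have := leq_mul lt lt; move: ff Ld h2; clear.
  by generalize (d * d) (L * (d * d)); lia.
by split => //; move: h2; clear; generalize (L * (d * d)); lia.
Qed.

Lemma sqr_mid x y z : x + z = 2 * y -> 2 * (y * y) <= x * x + z * z.
Proof.
move=> e; have : 2 * (x * z) <= x * x + z * z by rewrite !mulnn; apply: (nat_Cauchy x z).1.
have : (x + z) * (x + z) = (2 * y) * (2 * y) by rewrite e.
by clear; lia.
Qed.

(** The cases are the three ways the first coordinates can wrap. The second coordinates are compared
    after doubling because [tail] sees [t] only through 2t mod p. *)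
Lemma height_gap (p H b L R x1 x2 y1 y2 z1 z2 : nat) :
  4 * H < p -> p <= 4 * H + b -> b <= H ->
  3 * (p * p) <= L * (4 * (b * b)) -> 2 * (R * R) <= p * p ->
  x1 < p -> x2 < p -> y1 < p -> y2 < p -> z1 < p -> z2 < p ->
  core H b x1 x2 || tail p H b x1 x2 ->
  core H b y1 y2 || tail p H b y1 y2 ->
  core H b z1 z2 || tail p H b z1 z2 ->
  x1 + z1 = 2 * y1 %[mod p] -> x2 + z2 = 2 * y2 %[mod p] ->
  height p L x1 x2 + height p L z1 z2 < 2 * height p L y1 y2 + 2 * (R * R) ->
  [/\ x1 < z1 + 2 * R, z1 < x1 + 2 * R &
   exists u v, [/\ u = 2 * x2 %[mod p], v = 2 * z2 %[mod p], u < v + 4 * R & v < u + 4 * R]].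
Proof.
move=> Hp pH bH Lb Rp x1p x2p y1p y2p z1p z2p Tx Ty Tz e1 e2.
have p0 : 0 < p by apply: leq_ltn_trans y1p.
have L0 : 0 < L by case: L Lb => //; rewrite mul0n leqn0 !muln_eq0 /= orbb -leqn0 leqNgt p0.
have far : 2 * bowl p y1 + 4 * (b * b) <= bowl p x1 + bowl p z1 ->
    2 * height p L y1 y2 + 2 * (R * R) <= height p L x1 x2 + height p L z1 z2.
  exact: (@height_far p b L).
have cases w1 w2 : core H b w1 w2 || tail p H b w1 w2 ->
    [/\ 2 * w1 < p, w1 + b <= 2 * H, b <= w1, w2 < 2 * H & w2 < H + w1] \/
    [/\ (2 * w1 < p) = false, 2 * H + b <= w1, w1 <= 3 * H &
      2 * H + 2 * w1 <= (2 * w2) %% p + p].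
  case/orP => [/and4P[h1 h2 h3 h4]|/and3P[h1 h2 h3]]; [left|right]; split => //.
    by clear - Hp h2; lia.
  by apply/negbTE; rewrite -leqNgt; clear - pH h1; lia.
have ltu t : (2 * t) %% p < p by rewrite ltn_mod.
have {}e2 : (2 * x2) %% p + (2 * z2) %% p = 2 * ((2 * y2) %% p) %[mod p] /\
    x2 + z2 = (2 * y2) %% p %[mod p].
  split; last by rewrite modn_mod.
  by rewrite modnDm -mulnDr -modnMmr e2.
case: e2 => e2u e2.
have y1b : b <= y1 by case: (cases _ _ Ty) => -[h1 h2 h3 *] //; clear - h2; lia.
have [||w|w|w] := eqn_mod_cases e1.
- by clear - x1p z1p; lia.
- by clear - y1p; lia.
(* The removed strips keep core and tail at least 2b apart in the first coordinate, so a mixed pair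
   has bowl defect at least 4 b^2. *)
- have sep : 2 * b <= x1 - z1 + (z1 - x1) ->
      2 * height p L y1 y2 + 2 * (R * R) <= height p L x1 x2 + height p L z1 z2.
    move=> bd; apply: far; rewrite (bowl_mid _ _ _ w) ?(ltnW x1p) ?(ltnW y1p) ?(ltnW z1p) //.
    by rewrite leq_add2l -[4]/(2 * 2) mulnACA; apply: leq_mul.
  case: (cases _ _ Tx) (cases _ _ Tz) => [[hx1 hx2 hx3 hx4 hx5]|[hx1 hx2 hx3 hx4]]
     [[hz1 hz2 hz3 hz4 hz5]|[hz1 hz2 hz3 hz4]].
  (* With both ends in the core, so is the midpoint. All second-coordinate sums are below 4H < p,
     hence the congruence is an equality. *)
  + case: (cases _ _ Ty) => [[hy1 _ _ hy4 _]|[_ h _ _]]; last first.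
      by exfalso; clear - h hx2 hz2 w Hp pH; lia.
    have e2' : x2 + z2 = 2 * y2.
      have := e2; rewrite modn_mod !modn_small //; clear - Hp hx4 hz4 hy4; lia.
    rewrite /height hx1 hy1 hz1 => /(height_near L0 x1p y1p z1p w (sqr_mid e2'))[-> -> h].
    split => //; exists (2 * x2), (2 * z2); have [] := close_of_sqr e2' h.
    by clear; split => //; lia.
  + have /sep : 2 * b <= x1 - z1 + (z1 - x1) by clear - hx2 hz2; lia.
    by move=> h1 h2; move: h1; rewrite leqNgt h2.
  + have /sep : 2 * b <= x1 - z1 + (z1 - x1) by clear - hx2 hz2; lia.
    by move=> h1 h2; move: h1; rewrite leqNgt h2.
  + case: (cases _ _ Ty) => [[_ h _ _ _]|[hy1 hy2 _ hy4]].
      by exfalso; clear - h hx2 hz2 w Hp pH; lia.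
    (* The three doubled residues lie in [6H + 2b - p, p), of length at most p/2 since p <= 4H + b,
       so their congruence cannot wrap. *)
    have e2' : (2 * x2) %% p + (2 * z2) %% p = 2 * ((2 * y2) %% p).
      have := eqn_mod_cases e2u; move: (ltu x2) (ltu z2) (ltu y2) hx4 hz4 hy4.
      move: ((2 * x2) %% p) ((2 * y2) %% p) ((2 * z2) %% p) => u v t.
      clear - pH hx2 hy2 hz2 => h1 h2 h3 h4 h5 h6 []; lia.
    rewrite /height hx1 hy1 hz1 => /(height_near L0 x1p y1p z1p w (sqr_mid e2'))[-> -> h].
    split => //; exists ((2 * x2) %% p), ((2 * z2) %% p).
    have := close_of_sqr e2' h; rewrite !modn_mod.
    by move: ((2 * x2) %% p) ((2 * z2) %% p) => u v; clear => -[]; split => //; lia.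
- have F : 2 * bowl p y1 + 4 * (b * b) <= bowl p x1 + bowl p z1.
    apply: bowl_up w => //; rewrite ltnW //; exact: leq_ltn_trans y1b y1p.
  by move=> h; have := far F; rewrite leqNgt h.
(* Here 2 y1 = x1 + z1 + p, so [y] is in the tail. Two core ends give x2 + z2 < 2H + x1 + z1 = 2H +
   2 y1 - p, against the tail condition; a tail end would force y1 > 3H. *)
- exfalso.
  case: (cases _ _ Ty) => [[h _ _ _ _]|[hy1 hy2 hy3 hy4]]; first by clear - h w; lia.
  case: (cases _ _ Tx) (cases _ _ Tz) => [[hx1 hx2 hx3 hx4 hx5]|[hx1 hx2 hx3 hx4]]
     [[hz1 hz2 hz3 hz4 hz5]|[hz1 hz2 hz3 hz4]].
  + move: e2; rewrite modn_mod (modn_small (m := x2 + z2)); last by clear - Hp hx4 hz4; lia.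
    move=> e; move: hy4; rewrite -e; clear - w hx5 hz5; lia.
  + by clear - w hz2 hy3 Hp; lia.
  + by clear - w hx2 hy3 Hp; lia.
  + by clear - w hx2 hy3 Hp; lia.
Qed.

(** * Shells in a product of tori *)

HB.instance Definition _ (A B : finZmodType) := GRing.Zmodule.on (A * B)%type.
HB.instance Definition _ (aT : finType) (rT : finZmodType) :=
  GRing.Zmodule.on {ffun aT -> rT}.

Lemma mulrn_inj_coprime (V : zmodType) (p j : nat) :
  (forall x : V, (x *+ p)%R = 0%R) -> 0 < j -> coprime j p -> injective (fun x : V => (x *+ j)%R).
Proof.
move=> xp j0 /eqP g x y /= e; case: (egcdnP p j0) => u v uv _.
have red (w : V) : ((w *+ j) *+ u)%R = w.
  by rewrite -mulrnA mulnC uv g mulrnDr mulnC mulrnA xp mul0rn add0r.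
by rewrite -(red x) e red.
Qed.

Lemma pigeonhole (T : finType) (A : {set T}) (f : T -> nat) (n : nat) :
  (forall x, x \in A -> f x < n) -> exists j, #|A| <= n * #|[set x in A | f x == j]|.
Proof.
case: n => [fA|n fA].
  exists 0; rewrite mul0n leqn0 cards_eq0; apply/set0Pn => -[x /fA].
  by rewrite ltn0.
pose c (j : 'I_n.+1) := #|[set x in A | f x == j]|.
exists (val [arg max_(j > ord0) c j]); case: arg_maxnP => // j _ jmax.
have -> : #|A| = \sum_j c j.
  rewrite -sum1_card (partition_big (fun x => inord (f x) : 'I_n.+1) predT) //=.
  apply: eq_bigr => i _; rewrite sum1dep_card /c; apply: eq_card => x; rewrite !inE.
  apply: andb_id2l => xA; rewrite -val_eqE /= inordK //; exact: fA.
rewrite -[X in _ <= X * _]card_ord -sum_nat_const.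
by apply: leq_sum => i _; apply: jmax.
Qed.

Section Torus.

Variables (n k : nat).
Let p := n.+2.
Notation F := 'I_n.+2.
Notation V := {ffun 'I_k -> F * F}.

Lemma val_ordD (x y : F) : val (x + y)%R = (x + y) %% p.
Proof. by []. Qed.

Lemma ord_mulp (x : F) : (x *+ p)%R = 0%R.
Proof. by apply: val_inj; rewrite Zp_mulrn /= modnMl. Qed.

Lemma torus_mulp (x : V) : (x *+ p)%R = 0%R.
Proof.
apply/ffunP => i; rewrite ffunMnE ffunE.
have e1 : ((x i *+ p)%R).1 = 0%R by rewrite raddfMn ord_mulp.
have e2 : ((x i *+ p)%R).2 = 0%R by rewrite raddfMn ord_mulp.
by case: (x i *+ p)%R e1 e2 => a b /= -> ->.
Qed.

(* The [d] for which [4 d] has a representative in the interval [-4R, 4R). *)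
Definition near0 (R : nat) : {set F} :=
  (fun d : F => (d *+ 4 + inZp (4 * R))%R) @^-1: [set inZp (c : nat) | c : 'I_(8 * R)].

Lemma card_near0 R : coprime 4 p -> #|near0 R| <= 8 * R.
Proof.
move=> p4; rewrite card_preimset.
  by apply: leq_trans (leq_imset_card _ _) _; rewrite card_ord.
by move=> x y /addIr; apply: (mulrn_inj_coprime ord_mulp).
Qed.

Lemma inZpD (a b : nat) : (inZp (a + b) : F) = (inZp a + inZp b)%R.
Proof. by apply: val_inj; rewrite /= modnDm. Qed.

(** [v - u] represents 2(x + 2d) - 2x = 4d; the shift by 4R keeps it a natural number. *)
Lemma mem_near0 R (x d : F) u v :
  u = 2 * x %[mod p] -> v = 2 * (x + d *+ 2)%R %[mod p] ->
  u < v + 4 * R -> v < u + 4 * R -> d \in near0 R.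
Proof.
move=> eu ev uv vu; rewrite inE.
have c8 : v + 4 * R - u < 8 * R by lia.
apply/imsetP; exists (Ordinal c8) => //=.
have dbl (y : F) w : w = 2 * y %[mod p] -> (y *+ 2)%R = inZp w.
  by move=> ew; apply: val_inj; rewrite Zp_mulrn /= ew mulnC.
apply: (@addIr _ (x *+ 2)%R); rewrite {2}(dbl _ _ eu) -inZpD subnK; last by lia.
rewrite inZpD -(dbl _ _ ev) mulrnDl -mulrnA.
by rewrite addrAC [(d *+ _ + _)%R]addrC.
Qed.

Variables (H b L R : nat).

Definition region : {set F * F} := [set x : F * F | core H b x.1 x.2 || tail p H b x.1 x.2].

Definition total_height (x : V) := \sum_i height p L (x i).1 (x i).2.

Definition shell j : {set V} :=
  [set x : V in ffun_on (mem region) | total_height x %/ (R * R) == j].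

Hypotheses (Hp : 4 * H < p) (pH : p <= 4 * H + b) (bH : b <= H).
Hypotheses (Lb : 3 * (p * p) <= L * (4 * (b * b))) (R0 : 0 < R) (Rp : 2 * (R * R) <= p * p).

(** Heights in a shell differ by less than R^2, so the total defect is below 2 R^2. No coordinate
    has a negative defect, so [height_gap] applies to each one. *)
Lemma shell_ap j (x d : V) :
  x \in shell j -> (x + d)%R \in shell j -> (x + d *+ 2)%R \in shell j ->
  d \in [set d : V in ffun_on (mem (setX (near0 R) (near0 R)))].
Proof.
rewrite !inE => /andP[/ffun_onP xT /eqP xj] /andP[/ffun_onP yT /eqP yj] /andP[/ffun_onP zT /eqP zj].
have hlt w : total_height w %/ (R * R) = j ->
    j * (R * R) <= total_height w < j * (R * R) + R * R.
  move=> e; rewrite -e leq_divM /= [X in X < _](divn_eq _ (R * R)) ltn_add2l ltn_mod.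
  by rewrite muln_gt0 R0.
have gap : total_height x + total_height (x + d *+ 2)%R < 2 * total_height (x + d)%R + 2 * (R * R).
  move: (hlt _ xj) (hlt _ yj) (hlt _ zj); clear.
  by generalize (j * (R * R)) (total_height x) (total_height (x + d)%R) (total_height (x + d *+ 2)%R); lia.
have R00 : 2 * (0 * 0) <= p * p by [].
have ord_ap (a c : F) : (a + (a + c *+ 2)%R = 2 * (a + c)%R %[mod p])%N.
  rewrite -(modn_mod (a + _)) -val_ordD addrA -mulr2n -mulrnDl Zp_mulrn /=.
  by rewrite modn_mod mulnC.
have e1 i : ((x + d) i).1%R = ((x i).1 + (d i).1)%R by rewrite ffunE.
have e2 i : ((x + d) i).2%R = ((x i).2 + (d i).2)%R by rewrite ffunE.
have z1 i : ((x + d *+ 2) i).1%R = ((x i).1 + (d i).1 *+ 2)%R by rewrite ffunE ffunMnE.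
have z2 i : ((x + d *+ 2) i).2%R = ((x i).2 + (d i).2 *+ 2)%R by rewrite ffunE ffunMnE.
pose h (w : V) i := height p L (w i).1 (w i).2.
have gapi r i : 2 * (r * r) <= p * p -> h x i + h (x + d *+ 2)%R i < 2 * h (x + d)%R i + 2 * (r * r) ->
   [/\ (x i).1 < ((x i).1 + (d i).1 *+ 2)%R + 2 * r, ((x i).1 + (d i).1 *+ 2)%R < (x i).1 + 2 * r &
   exists u v, [/\ u = 2 * (x i).2 %[mod p], v = 2 * ((x i).2 + (d i).2 *+ 2)%R %[mod p],
     u < v + 4 * r & v < u + 4 * r]].
  move=> rp; rewrite /h e1 e2 z1 z2.
  have := xT i; have := yT i; have := zT i; rewrite !inE e1 e2 z1 z2.
  have := ord_ap (x i).1 (d i).1; have := ord_ap (x i).2 (d i).2.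
  move: ((x i).1 + (d i).1)%R ((x i).2 + (d i).2)%R => y1 y2.
  move: ((x i).1 + (d i).1 *+ 2)%R ((x i).2 + (d i).2 *+ 2)%R => w1 w2 a2 a1 tz ty tx.
  by apply: (height_gap Hp pH bH Lb rp) a1 a2; rewrite ?ltn_ord.
(* A negative defect would satisfy [height_gap] with radius 0, whose conclusion is two opposite
   strict inequalities. *)
have conv i : 2 * h (x + d)%R i <= h x i + h (x + d *+ 2)%R i.
  rewrite leqNgt; apply/negP => lt; case: (gapi 0 i R00); first by rewrite addn0.
  by rewrite !addn0 => h1 /(ltn_trans h1); rewrite ltnn.
apply/ffun_onP => i.
have : h x i + h (x + d *+ 2)%R i < 2 * h (x + d)%R i + 2 * (R * R).
  rewrite ltnNge; apply/negP => le; move: gap; rewrite ltnNge => /negP; apply.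
  rewrite /total_height -big_split /= big_distrr /= (bigD1 i) //= [X in _ <= X](bigD1 i) //=.
  rewrite addnAC; apply: leq_add le _.
  by apply: leq_sum => l _; apply: conv.
case/(gapi _ _ Rp) => h1 h2 [u [v [eu ev uv vu]]].
rewrite inE; apply/andP; split; last exact: mem_near0 eu ev uv vu.
apply: (@mem_near0 _ _ _ (2 * (x i).1) (2 * ((x i).1 + (d i).1 *+ 2)%R)) => //.
  by clear - h1; lia.
by clear - h2; lia.
Qed.

Lemma height_le (s t : F) : height p L s t <= (3 * L + 1) * (p * p).
Proof.
have hs := ltnW (ltn_ord s); have ht := ltnW (ltn_ord t).
rewrite /height mulnDl mul1n; apply: leq_add; last first.
  by case: ifP => _; apply: leq_mul => //; rewrite ltnW // ltn_mod.
rewrite -mulnA mulnCA leq_mul2l; apply/orP; right; rewrite /bowl -[3]/(2 + 1) mulnDl mul1n.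
by apply: leq_add; rewrite leq_mul2l ?leq_subr ?orbT // leq_mul.
Qed.

(** Sampling is applied to the most populated shell. Multiplication by each [j <= N] is injective
    because [p] is a prime above [N], and [card_near0] turns the last hypothesis into the required
    sparsity of [D]. *)
Lemma r3_ge_region N : coprime 4 p -> N < p -> prime p -> 2 * N * (8 * R) ^ (2 * k) <= p ^ (2 * k) ->
  N * #|region| ^ k <= 2 * p ^ (2 * k) * (k * (3 * L + 1) * (p * p) %/ (R * R)).+1 * r3 N.
Proof.
move=> p4 Np pp NR.
pose A := [set x : V in ffun_on (mem region)].
have cA : #|A| = #|region| ^ k.
  by rewrite cardsE card_ffun_on card_ord; congr (_ ^ _).
have [|j] := @pigeonhole _ A (fun x => total_height x %/ (R * R))
    (k * (3 * L + 1) * (p * p) %/ (R * R)).+1.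
  move=> x _; rewrite ltnS; apply: leq_div2r; rewrite -mulnA -[X in _ <= X * _]card_ord -sum_nat_const.
  by apply: leq_sum => i _; apply: height_le.
rewrite cA => cS.
have cV : #|{: V}| = p ^ (2 * k) by rewrite card_ffun card_prod !card_ord mulnn expnM.
pose D := [set d : V in ffun_on (mem (setX (near0 R) (near0 R)))].
have cD : #|D| <= (8 * R) ^ (2 * k).
  rewrite cardsE card_ffun_on card_ord expnM -mulnn.
  case: (k) => // k'; rewrite leq_exp2r //= cardsX.
  by apply: leq_mul; apply: card_near0.
have := @r3_ge_sampling V N (shell j) D _ (@shell_ap j) _.
rewrite cV => main.
have {}main : N * #|shell j| <= 2 * p ^ (2 * k) * r3 N.
  apply: main => [i i0 iN|].
    apply: (mulrn_inj_coprime torus_mulp) => //; rewrite coprime_sym prime_coprime //.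
    by apply/negP => /(dvdn_leq i0); rewrite leqNgt (leq_ltn_trans iN Np).
  by apply: leq_trans NR; rewrite leq_mul2l cD orbT.
move: main cS; have -> : shell j = [set x in A | total_height x %/ (R * R) == j].
  by apply/setP => x; rewrite !inE.
have arith N' s q r t c : N' * s <= 2 * q * r -> t <= c * s -> N' * t <= 2 * q * c * r.
  move=> h1 h2; apply: (@leq_trans (N' * (c * s))); first by rewrite leq_mul2l h2 orbT.
  by rewrite mulnCA [2 * q * c]mulnC -[c * _ * r]mulnA leq_mul2l h1 orbT.
exact: arith.
Qed.

End Torus.

(** * The density of the region *)

Lemma card_ord_lt p m : m <= p -> #|[set t : 'I_p | t < m]| = m.
Proof.
move=> mp; rewrite -sum1_card (eq_bigl (fun t : 'I_p => t < m)) => [|t]; last by rewrite inE.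
by rewrite -(big_ord_widen _ (fun => 1) mp) sum1_card card_ord.
Qed.

Lemma card_ord_ge p m : m <= p -> #|[set t : 'I_p | m <= t]| = p - m.
Proof.
move=> mp; have := cardsC [set t : 'I_p | t < m]; rewrite card_ord_lt // card_ord => e.
rewrite -[in RHS]e addKn; apply: eq_card => t; by rewrite !inE -leqNgt.
Qed.

Lemma sum_arith a m : 2 * (\sum_(0 <= i < m) (a + i)) + m = m * (2 * a + m).
Proof.
elim: m => [|m IH]; first by rewrite big_geq.
by rewrite big_nat_recr //= mulnDr; lia.
Qed.

Lemma sum_countdown m : \sum_(0 <= i < m) 2 * (m - i) = m * m.+1.
Proof.
elim: m => [|m IH]; first by rewrite big_geq.
by rewrite big_nat_recl //= IH subn0; lia.
Qed.

(** Three blocks of m = H - b columns suffice, with fibres of at least H + b + i, 2H and 2(m - i)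
    points; they sum to at least 9 m^2 / 2. *)
Lemma card_region n H b : coprime 4 n.+2 -> 4 * H < n.+2 -> b <= H ->
  9 * ((H - b) * (H - b)) <= 2 * #|region n H b|.
Proof.
set p := n.+2 => p4 Hp bH.
pose c s := #|[set t : 'I_n.+2 | core H b s t || tail p H b s t]|.
have -> : #|region n H b| = \sum_(0 <= s < p) c s.
  transitivity (\sum_(s < p) \sum_(t < p) if (s, t) \in region n H b then 1 else 0).
    by rewrite pair_bigA -sum1_card big_mkcond; apply: eq_bigr => -[].
  rewrite big_mkord; apply: eq_bigr => s _; rewrite /c -sum1_card [RHS]big_mkcond /=.
  by apply: eq_bigr => t _; rewrite !inE.
have [m Hm] : exists m, H = m + b by exists (H - b); rewrite subnK.
have -> : H - b = m by rewrite Hm addnK.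
have sub (P Q : pred 'I_n.+2) : (forall t, P t -> Q t) -> #|[set t | P t]| <= #|[set t | Q t]|.
  by move=> PQ; apply/subset_leq_card/subsetP => t; rewrite !inE; apply: PQ.
have c1 i : i < m -> H + b + i <= c (i + b).
  move=> im; rewrite -(@card_ord_lt n.+2 (H + b + i)); last by clear - im Hm Hp; lia.
  apply: sub => t /= ht; apply/orP; left; clear - im Hm ht; apply/and4P; split; lia.
have c2 i : i < m -> 2 * H <= c (i + H).
  move=> im; rewrite -(@card_ord_lt n.+2 (2 * H)); last by clear - im Hm Hp; lia.
  apply: sub => t /= ht; apply/orP; left; clear - im Hm ht; apply/and4P; split; lia.
have c3 i : i < m -> 2 * (m - i) <= c (i + (2 * H + b)).
  move=> im; apply: (@leq_trans (p - (2 * H + 2 * (i + (2 * H + b)) - p))).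
    by clear - im Hm Hp; lia.
  rewrite -card_ord_ge; last by clear - im Hm Hp; lia.
  (* Since [p] is odd, doubling permutes the residues, so a tail fibre is as large as the interval
     allowed for 2t mod p. *)
  have dinj : injective (fun t : 'I_n.+2 => (t *+ 2)%R).
    apply: (mulrn_inj_coprime (@ord_mulp n)) => //.
    by move: p4; rewrite (_ : 4 = 2 ^ 2) // coprime_pexpl.
  rewrite -(card_preimset _ dinj); apply/subset_leq_card/subsetP => t.
  rewrite !inE Zp_mulrn /= (mulnC t) => ht; apply/orP; right; rewrite /tail.
  move: ht; rewrite -/p; move: ((2 * t) %% p) => u ht; clear - im Hm ht; apply/and3P; split; lia.
have sum_le (u v : nat -> nat) : (forall i, i < m -> u i <= v i) ->
    \sum_(0 <= i < m) u i <= \sum_(0 <= i < m) v i.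
  by move=> uv; rewrite big_seq [X in _ <= X]big_seq; apply: leq_sum => i; rewrite mem_index_iota => /uv.
rewrite (@big_cat_nat _ _ _ b) //=; last by clear - Hm Hp; lia.
rewrite (@big_cat_nat _ _ _ H b) //=; last by clear - Hm Hp; lia.
rewrite (@big_cat_nat _ _ _ (m + H) H) //=; [|by clear; lia|by clear - Hm Hp; lia].
rewrite (@big_cat_nat _ _ _ (2 * H + b) (m + H)) //=; [|by clear - Hm Hp; lia|by clear - Hm Hp; lia].
rewrite (@big_cat_nat _ _ _ (m + (2 * H + b)) (2 * H + b)) //=;
  [|by clear - Hm Hp; lia|by clear - Hm Hp; lia].
have -> : \sum_(b <= i < H) c i = \sum_(0 <= i < m) c (i + b).
  by rewrite Hm -{1}[b]add0n big_addn addnK.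
have -> : \sum_(H <= i < m + H) c i = \sum_(0 <= i < m) c (i + H).
  by rewrite -{1}[H]add0n big_addn addnK.
have -> : \sum_(2 * H + b <= i < m + (2 * H + b)) c i = \sum_(0 <= i < m) c (i + (2 * H + b)).
  by rewrite -{1}[2 * H + b]add0n big_addn addnK.
have := sum_le _ _ c1; have := sum_le _ _ c2; have := sum_le _ _ c3.
rewrite sum_nat_const_nat subn0 sum_countdown.
have := sum_arith (H + b) m; clear - Hm.
set C1 := \sum_(0 <= i < m) c (i + b); set C2 := \sum_(0 <= i < m) c (i + H).
set C3 := \sum_(0 <= i < m) c (i + (2 * H + b)).
move: (\sum_(0 <= i < b) _) (\sum_(m + H <= i < _) _) (\sum_(m + (2 * H + b) <= i < _) _) => a1 a2 a3.
move: C1 C2 C3 (\sum_(0 <= i < m) (H + b + i)); move: (m) Hm => l -> {c}.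
by lia.
Qed.

(** The auxiliary prime cancels out. [M] sets the strip width; [m] sets the precision: 8R <= p/m
    gives (8R/p)^(2k) <= m^(-2k) <= 1/(2N). *)
Lemma r3_ge_nat (M k m N : nat) : 1 < M -> 0 < k -> 0 < m -> 2 * N <= m ^ (2 * k) ->
  N * (9 * ((M - 2) * (M - 2))) ^ k <= 2 * 250 * 256 * (M * M * k * (m * m)) * (32 * (M * M)) ^ k * r3 N.
Proof.
move=> M1 k0 m0 Nm.
have [p pbig pp] := prime_above (N + 16 * M + 8 * m + 4).
have Np : N < p by clear - pbig; lia.
have Mp : 16 * M < p by clear - pbig; lia.
have mp : 8 * m < p by clear - pbig; lia.
have p4 : 4 < p by clear - pbig; lia.
have odd_p : coprime 4 p.
  rewrite (_ : 4 = 2 ^ 2) // coprime_pexpl // coprime2n; apply/negPn/negP => ev.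
  by have /prime_oddPn := pp; case/(_ ev) => e; move: p4; rewrite e.
have [n ep] : exists n, p = n.+2 by exists p.-2; clear - p4; lia.
set H := p %/ 4; set b := H %/ M; set R := p %/ (8 * m).
have M0 : 0 < M by clear - M1; lia.
have Hp : 4 * H <= p by rewrite mulnC leq_divM.
have pH : p < 4 * H.+1 by rewrite mulnC -ltn_divLR.
have Hp' : 4 * H < p.
  rewrite ltn_neqAle Hp andbT; apply/negP => /eqP e; move: odd_p.
  by rewrite -e /coprime gcdnMr.
have bM : b * M <= H by rewrite leq_divM.
have Mb : H < b.+1 * M by rewrite -ltn_divLR.
(* This absorbs the remainder of [p] modulo 4, giving p <= 4H + b. *)
have b3 : 3 <= b by rewrite leq_divRL //; clear - Mp pH; lia.
have bH : b <= H by apply: leq_trans bM; rewrite leq_pmulr.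
have Rm : R * (8 * m) <= p by rewrite leq_divM.
have mR : p < R.+1 * (8 * m) by rewrite -ltn_divLR // muln_gt0.
have R0 : 0 < R by rewrite divn_gt0 ?muln_gt0 // ltnW.
have p8 : p <= 8 * (b * M).
  have : 3 * M <= b * M by rewrite leq_mul2r b3 orbT.
  by move: pH Mb; rewrite mulSn; clear; lia.
(* [L] is 75 M^2, which is large enough because p <= 8 b M. *)
have Lb : 3 * (p * p) <= 75 * (M * M) * (4 * (b * b)).
  by have := leq_mul p8 p8; clear; lia.
have Rp : 2 * (R * R) <= p * p.
  have R8 : 8 * R <= p by apply: leq_trans Rm; rewrite mulnC leq_mul2l leq_pmulr ?orbT.
  by have := leq_mul R8 R8; clear; lia.
have p16 : p <= 16 * (R * m).
  have : m <= R * m by rewrite leq_pmull.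
  by move: mR; rewrite mulSn; clear; lia.
(* One unit of [M] is lost to the strips, the other to rounding in [p %/ 4]. *)
have h4 : (M - 2) * p <= 4 * ((H - b) * M).
  have [l el] : exists l, M = l + 2 by exists (M - 2); rewrite subnK.
  have : (H - b) * M + b * M = H * M by rewrite -mulnDl subnK.
  rewrite el addnK => e.
  have : l.+1 * p <= l.+1 * (4 * H + 3) by rewrite leq_mul2l; apply/orP; right; clear - pH; lia.
  by move: e bM Mp; rewrite el; move: ((H - b) * (l + 2)) (b * (l + 2)); clear; lia.
have [c [cH main]] : exists c, 9 * ((H - b) * (H - b)) <= 2 * c /\
    (2 * N * (8 * R) ^ (2 * k) <= p ^ (2 * k) ->
     N * c ^ k <= 2 * p ^ (2 * k) *
       (k * (3 * (75 * (M * M)) + 1) * (p * p) %/ (R * R)).+1 * r3 N).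
  have pHb : p <= 4 * H + b by clear - pH b3; lia.
  move: H b R Hp' pHb bH Lb R0 Rp odd_p Np pp {Hp pH bM Mb b3 Rm mR p8 p16 h4 pbig Mp mp p4}.
  rewrite ep => H b R Hp' pHb bH Lb R0 Rp odd_p Np pp.
  by exists #|region n H b|; split; [exact: card_region | exact: r3_ge_region].
have cR : 9 * ((M - 2) * (M - 2)) * (p * p) <= 32 * (M * M) * c.
  have := leq_mul h4 h4; move: cH; move: (H - b) (M - 2) => h l.
  clear => h1 h2; have := leq_mul (leqnn (16 * (M * M))) h1; lia.
(* 256 comes from p <= 16 R m and 226 from 3 * 75 + 1; rounding up to 250 absorbs the successor in
   the number of shells. *)
have {}main : N * c ^ k <= 2 * p ^ (2 * k) * (250 * 256 * (M * M * k * (m * m))) * r3 N.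
  apply: leq_trans (main _) _.
  - apply: (@leq_trans (m ^ (2 * k) * (8 * R) ^ (2 * k))); first by rewrite leq_mul2r Nm orbT.
    rewrite -expnMn leq_exp2r ?muln_gt0 // mulnC.
    by apply: leq_trans Rm; rewrite -mulnA mulnCA.
  rewrite leq_mul2r; apply/orP; right; rewrite leq_mul2l; apply/orP; right.
  set K := k * (3 * (75 * (M * M)) + 1).
  have : K * (p * p) %/ (R * R) <= K * (256 * (m * m)).
    apply: leq_trans (leq_div2r _ (leq_mul (leqnn K) (leq_mul p16 p16))) _.
    rewrite (_ : K * _ = K * (256 * (m * m)) * (R * R)); last by move: K; clear; lia.
    by rewrite mulnK // muln_gt0 R0.
  have k1 : 1 <= k * (m * m) by rewrite !muln_gt0 k0 m0.
  have M1' : 1 <= M * M by rewrite muln_gt0 M0.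
  have : K <= 226 * (k * (M * M)).
    have : k * 1 <= k * (M * M) by rewrite leq_mul2l M1' orbT.
    by rewrite /K; clear; lia.
  move=> Kle h; apply: leq_ltn_trans h _.
  apply: leq_ltn_trans (leq_mul Kle (leqnn _)) _.
  by have := leq_mul M1' k1; clear; lia.
have pk : 0 < p ^ (2 * k) by rewrite expn_gt0; clear - p4; lia.
rewrite -(leq_pmul2l pk).
have e2 : p ^ (2 * k) = (p * p) ^ k by rewrite expnM mulnn.
have : N * ((9 * ((M - 2) * (M - 2))) ^ k * p ^ (2 * k)) <=
       (32 * (M * M)) ^ k * (N * c ^ k).
  rewrite [leqRHS]mulnCA leq_mul2l; apply/orP; right.
  by rewrite e2 -!expnMn leq_exp2r.
have := leq_mul (leqnn ((32 * (M * M)) ^ k)) main.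
move: ((32 * (M * M)) ^ k) ((9 * ((M - 2) * (M - 2))) ^ k) (p ^ (2 * k)) (c ^ k) (r3 N).
move: (M * M * k * (m * m)); clear => d x y q t r h1 h2.
by move: (leq_trans h2 h1); clear; lia.
Qed.

(** * Asymptotics *)

Open Scope R_scope.

Lemma INR_expn (m k : nat) : INR (expn m k) = INR m ^ k.
Proof. by elim: k => [|k IH]; rewrite ?expn0 // expnS mult_INR IH. Qed.

Lemma ln_quot (x y : R) : 0 < x -> 0 < y -> ln (x / y) = ln x - ln y.
Proof. by move=> x0 y0; rewrite /Rdiv ln_mult ?ln_Rinv //; apply: Rinv_0_lt_compat. Qed.

Lemma ln_le_sub1 (x : R) : 0 < x -> ln x <= x - 1.
Proof.
move=> x0; have := exp_ineq1_le (ln x); rewrite exp_ln //; lra.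
Qed.

Lemma ln_le_mono (x y : R) : 0 < x -> x <= y -> ln x <= ln y.
Proof. by move=> x0 [/(ln_increasing _ _ x0)|->]; [left | right]. Qed.

Lemma nat_ceil (x : R) : 0 <= x -> exists k : nat, x <= INR k <= x + 1.
Proof.
move=> x0; have [h1 h2] := archimed x.
have [|k ek] := IZN (up x); first by apply: le_IZR; lra.
by exists k; rewrite INR_IZR_INZ -ek; lra.
Qed.

Lemma r3_gt0 (N : nat) : (0 < N)%nat -> (0 < r3 N)%nat.
Proof.
move=> N0; have N1 : (1 < N.+1)%nat by [].
apply: leq_trans (@leq_r3 N [set Ordinal N1] _ _); first by rewrite cards1.
  by move=> x; rewrite inE => /eqP ->.
by move=> x y z; rewrite !inE => /eqP -> /eqP -> /eqP ->.
Qed.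

(** Logarithm of [r3_ge_nat]: 128000 = 2 * 250 * 256, and 4/(M - 2) bounds 2 (ln M - ln (M - 2)). *)
Lemma ln_r3_ge (M k m N : nat) : (2 < M)%nat -> (0 < k)%nat -> (0 < m)%nat -> (0 < N)%nat ->
  2 * INR N <= INR m ^ (2 * k)%nat ->
  ln (INR N) - ln (INR (r3 N)) <=
    INR k * (ln (32 / 9) + 4 / (INR M - 2)) + 2 * ln (INR m) + ln (INR k) +
    (ln 128000 + 2 * ln (INR M)).
Proof.
move=> M2 k0 m0 N0 Nm.
have nat_ineq : (2 * N <= expn m (2 * k))%nat.
  by apply/leP/INR_le; rewrite INR_expn mult_INR.
have INR_pos j : (0 < j)%nat -> 0 < INR j by move=> /ltP; apply: lt_0_INR.
have M1 : (1 < M)%nat by apply: ltn_trans M2.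
have := r3_ge_nat M1 k0 m0 nat_ineq => /leP/le_INR.
have eM : INR (M - 2)%nat = INR M - 2.
  by rewrite minus_INR //; apply/leP.
have M3 : 0 < INR M - 2 by rewrite -eM; apply: INR_pos; rewrite subn_gt0.
have c0 : INR 2 * INR 250 * INR 256 = 128000.
  by rewrite !INR_IZR_INZ /=; lra.
rewrite !mult_INR !INR_expn !mult_INR eM.
rewrite c0.
have -> : INR 9 = 9 by rewrite INR_IZR_INZ.
have -> : INR 32 = 32 by rewrite INR_IZR_INZ.
have := INR_pos _ N0; have := INR_pos _ m0; have := INR_pos _ k0.
have := INR_pos _ (r3_gt0 N0).
have Mpos : 0 < INR M by lra.
move: (INR (r3 N)) (INR N) (INR m) (INR M) M3 Mpos => r n mu W W2 W0 r0 kp mp np h.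
have key (a b c u : R) : 0 < a -> 0 < b -> 0 < c -> 0 < u ->
    n * (b * (u * u)) ^ k <= c * (W * W * INR k * (mu * mu)) * (a * (W * W)) ^ k * r ->
    ln n + INR k * (ln b + 2 * ln u) <=
    ln c + 2 * ln W + ln (INR k) + 2 * ln mu + INR k * (ln a + 2 * ln W) + ln r.
  move=> a0 b0 c0' u0 hk.
  have pos2 v w : 0 < v -> 0 < w -> 0 < v * w by apply: Rmult_lt_0_compat.
  have posk v : 0 < v -> 0 < v ^ k by apply: pow_lt.
  have := ln_le_mono _ hk; rewrite !ln_mult ?ln_pow ?ln_mult; try by auto 10.
  by move=> hl; have := hl (pos2 _ _ np (posk _ (pos2 _ _ b0 (pos2 _ _ u0 u0)))); lra.
have {key h}hl := key 32 9 128000 (W - 2) ltac:(lra) ltac:(lra) ltac:(lra) ltac:(lra) h.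
have e329 : ln (32 / 9) = ln 32 - ln 9 by rewrite ln_quot; lra.
have lW : ln W - ln (W - 2) <= 2 / (W - 2).
  rewrite -ln_quot //; apply: Rle_trans (ln_le_sub1 _) _; first exact: Rdiv_lt_0_compat.
  by right; field; lra.
have lk : INR k * (2 * (ln W - ln (W - 2))) <= INR k * (4 / (W - 2)).
  by apply: Rmult_le_compat_l; [lra | lra].
rewrite e329; lra.
Qed.

(** With l = ln N, the main terms are k A and 2 ln m, about l/k; k near sqrt(l/A) makes both about
    sqrt(A l). [M] depends only on [eta]. *)
Lemma ln_r3_asymptotic (eta : R) : 0 < eta -> exists C : R, forall N : nat, (1 < N)%nat ->
  ln (INR N) - ln (INR (r3 N)) <=
    2 * sqrt (ln (32 / 9) * ln (INR N)) + eta * sqrt (ln (INR N)) + C.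
Proof.
set A := ln (32 / 9) => eta0.
have A0 : 0 < A by rewrite /A -ln_1; apply: ln_increasing; lra.
have sA0 : 0 < sqrt A by apply: sqrt_lt_R0.
(* Two errors of size d x occur, from 4/(M - 2) and from ln k; together they make eta sqrt(l). *)
pose d := eta * sqrt A / 2.
have d0 : 0 < d by rewrite /d; nra.
have [M [hM _]] : exists M : nat, 3 + 4 / d <= INR M <= 3 + 4 / d + 1.
  by apply: nat_ceil; have := Rdiv_lt_0_compat 4 d; lra.
have d4 : 0 < 4 / d by apply: Rdiv_lt_0_compat; lra.
have M2 : (2 < M)%nat.
  by apply/ltP; apply: INR_lt; rewrite [INR 2]/=; lra.
have Md : 4 / (INR M - 2) <= d.
  apply: (Rmult_le_reg_r (INR M - 2)); first lra.
  rewrite /Rdiv Rmult_assoc Rinv_l; last lra.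
  have -> : 4 * 1 = d * (4 / d) by field; lra.
  by apply: Rmult_le_compat_l; lra.
exists (A + d + 3 * ln 2 + (2 * d - ln d) + (ln 128000 + 2 * ln (INR M))) => N N1.
have N2 : 1 < INR N by rewrite -[1]/(INR 1); apply: lt_INR; apply/ltP.
set l := ln (INR N).
have l0 : 0 < l by rewrite /l -ln_1; apply: ln_increasing; lra.
set x := sqrt l / sqrt A.
have sl0 : 0 < sqrt l by apply: sqrt_lt_R0.
have x0 : 0 < x by apply: Rdiv_lt_0_compat.
have [k [xk kx]] : exists k : nat, x <= INR k <= x + 1 by apply: nat_ceil; lra.
have k0 : (0 < k)%nat by apply/ltP; apply: INR_lt; rewrite [INR 0]/=; lra.
have k1 : 1 <= INR k by rewrite -[1]/(INR 1); apply: le_INR; apply/leP.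
have ln2 : 0 < ln 2 by rewrite -ln_1; apply: ln_increasing; lra.
(* y = (2N)^(1/(2k)); its ceiling [m] is at most 2y because y >= 1. *)
set y := exp ((l + ln 2) / (2 * INR k)).
have e0 : 0 < (l + ln 2) / (2 * INR k) by apply: Rdiv_lt_0_compat; lra.
have y1 : 1 <= y by have := exp_ineq1_le ((l + ln 2) / (2 * INR k)); rewrite -/y; lra.
have [m [ym my]] : exists m : nat, y <= INR m <= y + 1 by apply: nat_ceil; lra.
have m0 : (0 < m)%nat by apply/ltP; apply: INR_lt; rewrite [INR 0]/=; lra.
have Nm : 2 * INR N <= INR m ^ (2 * k)%nat.
  apply: Rle_trans (pow_incr y _ _ _); last lra.
  right; apply: ln_inv; [lra | by apply: pow_lt; lra |].
  rewrite ln_pow; last lra.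
  rewrite ln_mult; [|lra|lra].
  by rewrite /y ln_exp mult_INR [INR 2]/= -/l; field; lra.
have N0 : (0 < N)%nat by apply: ltnW.
apply: Rle_trans (ln_r3_ge M2 k0 m0 N0 Nm) _; rewrite -/A.
have lm : 2 * ln (INR m) <= 3 * ln 2 + sqrt (A * l).
  have : ln (INR m) <= ln (2 * y) by apply: ln_le_mono; lra.
  rewrite ln_mult; [|lra|lra].
  rewrite /y ln_exp => h.
  have h2 : l / INR k <= sqrt (A * l).
    apply: (Rmult_le_reg_r (INR k)); first lra.
    rewrite /Rdiv Rmult_assoc Rinv_l; last lra.
    apply: (Rle_trans _ (sqrt (A * l) * x)).
      right; rewrite /x sqrt_mult; [|lra|lra].
      by rewrite Rmult_1_r -{1}(sqrt_sqrt l); [field|]; lra.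
    by apply: Rmult_le_compat_l => //; apply: sqrt_pos.
  have h3 : ln 2 / INR k <= ln 2.
    apply: (Rmult_le_reg_r (INR k)); first lra.
    by rewrite /Rdiv Rmult_assoc Rinv_l; [nra | lra].
  have : 2 * ((l + ln 2) / (2 * INR k)) = l / INR k + ln 2 / INR k by field; lra.
  lra.
(* This is ln u <= u - 1 at u = d k. *)
have lk : ln (INR k) <= d * x + (2 * d - ln d).
  have := ln_le_sub1 (Rmult_lt_0_compat d (INR k) d0 _); rewrite ln_mult; try lra.
  have : d * INR k <= d * (x + 1) by apply: Rmult_le_compat_l; lra.
  move=> h1 h2; have := h2 _; lra.
have Ax : A * x = sqrt (A * l).
  rewrite /x sqrt_mult; [|lra|lra].
  by rewrite -{1}(sqrt_sqrt A); [field|]; lra.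
have dx : 2 * d * x = eta * sqrt l by rewrite /d /x; field; lra.
have kA : INR k * (A + 4 / (INR M - 2)) <= (x + 1) * (A + d).
  apply: Rmult_le_compat; try lra.
  have := Rdiv_lt_0_compat 4 (INR M - 2); lra.
lra.
Qed.

Theorem theorem1p1 :
  exists (C : R) (f : nat -> R),
    0 < C /\
    (forall eps : R, 0 < eps -> exists M : nat, forall N : nat, (M <= N)%nat -> Rabs (f N) < eps) /\
    (forall N : nat, (1 <= N)%nat ->
       INR (r3 N) >= C * INR N *
         Rpower 2 (- ((c_const + f N) * (2 * sqrt (2 * log2 (INR N)))))).
Proof.
have ln2 : 0 < ln 2 by rewrite -ln_1; apply: ln_increasing; lra.
set A := ln (32 / 9).
have A0 : 0 < A by rewrite /A -ln_1; apply: ln_increasing; lra.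
(* [B N] is the natural logarithm of 2^(2 sqrt(2 log2 N)). *)
pose B (N : nat) := 2 * sqrt (2 * log2 (INR N)) * ln 2.
pose be := 2 * sqrt (2 * ln 2).
have be0 : 0 < be by rewrite /be; have := sqrt_lt_R0 (2 * ln 2); lra.
have BE N : (1 < N)%nat -> [/\ 0 < ln (INR N), B N = be * sqrt (ln (INR N)) &
    c_const * B N = 2 * sqrt (A * ln (INR N))].
  move=> N1; have N2 : 1 < INR N by rewrite -[1]/(INR 1); apply: lt_INR; apply/ltP.
  have l0 : 0 < ln (INR N) by rewrite -ln_1; apply: ln_increasing; lra.
  have eB : B N = be * sqrt (ln (INR N)).
    rewrite /B /be /log2; set q := ln (INR N) / ln 2.
    have q0 : 0 < q by apply: Rdiv_lt_0_compat.
    have -> : ln (INR N) = q * ln 2 by rewrite /q; field; lra.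
    rewrite (sqrt_mult 2 q) ?(sqrt_mult 2 (ln 2)) ?(sqrt_mult q (ln 2)); try lra.
    transitivity (2 * (sqrt 2 * sqrt q) * (sqrt (ln 2) * sqrt (ln 2))); last ring.
    by rewrite sqrt_sqrt; lra.
   split=> //; rewrite eB /be /c_const /log2.
  (* [c_const]^2 = A / (2 ln 2) and [be]^2 = 8 ln 2, so their product is 4A. *)
  have -> : ln (sqrt (32 / 9)) = A / 2.
    rewrite /A -{2}(sqrt_sqrt (32 / 9)); last lra.
    by rewrite ln_mult; [field | apply: sqrt_lt_R0; lra | apply: sqrt_lt_R0; lra].
  have q0 : 0 <= A / 2 / ln 2 by left; apply: Rdiv_lt_0_compat; lra.
  rewrite Rmult_assoc (Rmult_comm (sqrt _)) Rmult_assoc -!sqrt_mult; try nra.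
  by congr (_ * sqrt _); field; lra.
(* For N > 1 this is the least nonnegative correction that gives the bound with constant 1. *)
pose f N := Rmax 0 ((ln (INR N) - ln (INR (r3 N))) / B N - c_const).
exists 1, f; split; first lra; split.
- move=> eps eps0.
  have [|C hC] := @ln_r3_asymptotic (be * eps / 2); first nra.
  (* Half of [eps] pays for the [eta] term; the other half pays for [C] once sqrt(ln N) > Q. *)
  pose Q := 2 * Rabs C / (be * eps).
  have bee : 0 < be * eps by nra.
  have Q0 : 0 <= Q.
    apply: Rmult_le_pos; first by have := Rabs_pos C; lra.
    by left; apply: Rinv_0_lt_compat.
  have [K hK] := INR_unbounded (exp (Q * Q)).
  exists (maxn 2 K) => N; rewrite geq_max => /andP[N1 KN].
  have [l0 eB cB] := BE N N1.
  have Ql : Q < sqrt (ln (INR N)).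
    rewrite -{1}(sqrt_square Q) //; apply: sqrt_lt_1; [nra | lra |].
    rewrite -(ln_exp (Q * Q)); apply: ln_increasing; first exact: exp_pos.
    by apply: Rlt_le_trans hK _; apply: le_INR; apply/leP.
  have B0 : 0 < B N by rewrite eB; apply: Rmult_lt_0_compat => //; apply: sqrt_lt_R0.
  rewrite Rabs_pos_eq; last exact: Rmax_l.
  apply: Rmax_lub_lt => //.
  suff : (ln (INR N) - ln (INR (r3 N))) / B N < c_const + eps by lra.
  apply: (Rmult_lt_reg_r (B N)) => //.
  rewrite /Rdiv Rmult_assoc Rinv_l ?Rmult_1_r; last lra.
  apply: Rle_lt_trans (hC N N1) _.
  rewrite Rmult_plus_distr_r cB -/A eB.
  have : Rabs C = Q * (be * eps / 2) by rewrite /Q; field; nra.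
  have := Rle_abs C.
  have : Q * (be * eps / 2) < sqrt (ln (INR N)) * (be * eps / 2).
    by apply: Rmult_lt_compat_r; lra.
  by lra.
- move=> N N1.
  have r0 : (0 < r3 N)%nat by apply: r3_gt0.
  have r1 : 1 <= INR (r3 N) by rewrite -[1]/(INR 1); apply: le_INR; apply/leP.
  have N0 : 0 < INR N by apply: lt_0_INR; apply/ltP.
  rewrite Rmult_1_l /Rpower; apply: Rle_ge.
  (* At N = 1 the divisor [B N] in [f] is 0, but the exponent vanishes too and the claim is
     [r3 1 >= 1]. *)
  case: (leqP N 1) => N2.
    have eN : INR N = 1.
      by rewrite -[1]/(INR 1); congr INR; apply/eqP; rewrite eqn_leq N1 N2.
    rewrite eN /log2 ln_1 /Rdiv Rmult_0_l Rmult_0_r sqrt_0 !Rmult_0_r.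
    by rewrite Ropp_0 Rmult_0_l exp_0; lra.
  have [l0 eB cB] := BE N N2.
  have B0 : 0 < B N by rewrite eB; apply: Rmult_lt_0_compat => //; apply: sqrt_lt_R0.
  have hf : ln (INR N) - ln (INR (r3 N)) <= (c_const + f N) * B N.
    have := Rmax_r 0 ((ln (INR N) - ln (INR (r3 N))) / B N - c_const); rewrite -/(f N) => h.
    have -> : ln (INR N) - ln (INR (r3 N)) = (ln (INR N) - ln (INR (r3 N))) / B N * B N.
      by field; lra.
    by apply: Rmult_le_compat_r; lra.
  rewrite -{1}(exp_ln (INR N)) // -exp_plus -(exp_ln (INR (r3 N))); last lra.
  have e : - ((c_const + f N) * (2 * sqrt (2 * log2 (INR N)))) * ln 2 = - ((c_const + f N) * B N).
    by rewrite /B; ring.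
  rewrite e; set v := ln (INR N) + _; have : v <= ln (INR (r3 N)) by rewrite /v; lra.
  by case=> [/exp_increasing|->]; [left | right].
Qed.
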